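(* Let $X$ be a real Hilbert space. Let $F\colon X\to X$ be firmly nonexpansive, let $(z_n)_{n\in\mathbb{N}}$ be a sequence in $X$ such that $(z_n)_{n\in\mathbb{N}}$ converges weakly to $z\in X$, suppose that $Fz_n\rightharpoonup x\in X$, and that $C$ and $D$ are closed affine subspaces of $X$ such that $D-D=(C-C)^\perp$, $Fz_n-P_CFz_n\to 0$, and $(z_n-Fz_n)-P_D(z_n-Fz_n)\to 0$. Then $x\in C$, $z\in x+D$, and $x=Fz$.
   Context: $X$ is a real Hilbert space with inner product $\langle\cdot,\cdot\rangle$ and induced norm $\|\cdot\|$. $\rightharpoonup$ denotes weak convergence and $\to$ denotes norm (strong) convergence. A mapping $F\colon X\to X$ is firmly nonexpansive if $\|Fx-Fy\|^2+\|(\mathrm{Id}-F)x-(\mathrm{Id}-F)y\|^2\le\|x-y\|^2$ for all $x,y\in X$, where $\mathrm{Id}$ is the identity operator. Affine subspaces are understood to be nonempty. For an affine subspace $C$, $C-C=\{c-c'\mid c,c'\in C\}$ is the linear subspace parallel to $C$, and $\perp$ denotes orthogonal complement. For a nonempty closed convex set $S\subseteq X$, $P_S$ is the projector (nearest point mapping) onto $S$. *)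

(* Defs.v *)
From HB Require Import structures.
From mathcomp Require Import all_boot all_order all_algebra.
From mathcomp Require Import sesquilinear.
From mathcomp Require Import all_classical all_reals all_analysis.

Set Implicit Arguments.
Unset Strict Implicit.
Unset Printing Implicit Defensive.

Import Order.TTheory GRing.Theory Num.Theory.
Import numFieldNormedType.Exports.

Local Open Scope classical_set_scope.
Local Open Scope ring_scope.

(* A real Hilbert space is a complete normed module over the reals together
   with an inner product (a symmetric positive definite bilinear form) whose
   induced norm is the norm of the space. *)
Definition induces_norm (R : realType) (X : completeNormedModType R)
    (ip : {dot X for idfun}) : Prop :=
  forall x : X, `|x| = Num.sqrt (ip x x).

Definition weakly_cvg_to (R : realType) (X : completeNormedModType R)
    (ip : {dot X for idfun}) (u : nat -> X) (l : X) : Prop :=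
  forall y : X, ip (u n) y @[n --> \oo] --> ip l y.

Definition orthogonal_complement (R : realType) (X : completeNormedModType R)
    (ip : {dot X for idfun}) (A : set X) : set X :=
  [set x | forall a, A a -> ip x a = 0].

Definition firmly_nonexpansive (R : realType) (X : normedModType R)
    (F : X -> X) : Prop :=
  forall x y : X,
    `|F x - F y| ^+ 2 + `|(x - F x) - (y - F y)| ^+ 2 <= `|x - y| ^+ 2.

Definition affine_subspace (R : realType) (X : lmodType R) (A : set X) : Prop :=
  A !=set0 /\
  forall (x y : X) (t : R), A x -> A y -> A (t *: x + (1 - t) *: y).

Definition set_sub (X : zmodType) (A B : set X) : set X :=
  [set a - b | a in A & b in B].

Definition translate (X : zmodType) (x : X) (A : set X) : set X :=
  [set x + a | a in A].

Definition nearest_point (R : realType) (X : normedModType R) (S : set X)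
    (x p : X) : Prop :=
  S p /\ forall s, S s -> `|x - p| <= `|x - s|.

(* In a Hilbert space the nearest point exists and is unique when S is
   nonempty, closed and convex; the default value 0 is only taken when no
   nearest point exists. *)
Definition projector (R : realType) (X : normedModType R) (S : set X) (x : X) : X :=
  xget 0 (nearest_point S x).

(* Main.v *)
(* Closed affine subspaces are weakly closed, which gives C x and D (z - x).
   Since D - D is orthogonal to C - C, the inner products of F z_n with
   z_n - F z_n converge to that of x with z - x, the errors being controlled by
   the boundedness of weakly convergent sequences (Banach-Steinhaus).
   Firm nonexpansiveness says that F z_n - F z and
   (z_n - F z_n) - (z - F z) have nonnegative inner product; in the limit this
   reads 0 <= - `|x - F z| ^+ 2. *)
Require Import Defs.
From HB Require Import structures.
From mathcomp Require Import all_boot all_order all_algebra.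
From mathcomp Require Import sesquilinear.
From mathcomp Require Import all_classical all_reals all_analysis.
From mathcomp Require Import ring lra.

Set Implicit Arguments.
Unset Strict Implicit.
Unset Printing Implicit Defensive.

Import Order.TTheory GRing.Theory Num.Theory.
Import numFieldNormedType.Exports.

Local Open Scope classical_set_scope.
Local Open Scope ring_scope.

Section InnerProduct.
Variables (R : realType) (X : completeNormedModType R) (ip : {dot X for idfun}).
Hypothesis ip_norm : induces_norm ip.
Implicit Types (x y z p : X) (A : set X) (u v : nat -> X).

Lemma ipC x y : ip x y = ip y x.
Proof. by rewrite (@hermC R false idfun X ip) expr0 mul1r. Qed.

Lemma ipDl x y z : ip (x + y) z = ip x z + ip y z.
Proof. exact: linearDl. Qed.

Lemma ipDr x y z : ip x (y + z) = ip x y + ip x z.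
Proof. exact: linearDr. Qed.

Lemma ipNr x y : ip x (- y) = - ip x y.
Proof. exact: linearNr. Qed.

Lemma ipBl x y z : ip (x - y) z = ip x z - ip y z.
Proof. exact: linearBl. Qed.

Lemma ipBr x y z : ip x (y - z) = ip x y - ip x z.
Proof. exact: linearBr. Qed.

Lemma ipZr (a : R) x y : ip x (a *: y) = a * ip x y.
Proof. by rewrite linearZr_LR. Qed.

Lemma ipxx x : ip x x = `|x| ^+ 2.
Proof.
rewrite ip_norm sqr_sqrtr//; have [->|x0] := eqVneq x 0.
  by rewrite linear0l.
exact/ltW/(@neq0_dnorm_gt0 _ _ _ ip).
Qed.

Lemma sqr_normD x y : `|x + y| ^+ 2 = `|x| ^+ 2 + `|y| ^+ 2 + 2 * ip x y.
Proof. by rewrite -!ipxx ipDl 2!ipDr (ipC y x) /=; ring. Qed.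

Lemma sqr_normB x y : `|x - y| ^+ 2 = `|x| ^+ 2 + `|y| ^+ 2 - 2 * ip x y.
Proof. by rewrite sqr_normD normrN ipNr mulrN. Qed.

(** The triangle inequality for the given norm, squared and expanded, is the upper bound; replacing
    [y] by [- y] yields the lower one. *)
Lemma cauchy_schwarz x y : `|ip x y| <= `|x| * `|y|.
Proof.
have le (w : X) : ip x w <= `|x| * `|w|.
  have : `|x + w| ^+ 2 <= (`|x| + `|w|) ^+ 2.
    by rewrite lerXn2r ?nnegrE ?addr_ge0// ler_normD.
  by rewrite sqr_normD sqrrD; lra.
rewrite ler_norml le andbT lerNl.
by have := le (- y); rewrite normrN ipNr.
Qed.

Lemma ip_cvg0l u v (M : R) : (forall n, `|v n| <= M) ->
  u n @[n --> \oo] --> (0 : X) -> ip (u n) (v n) @[n --> \oo] --> (0 : R).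
Proof.
move=> vM u0; apply/norm_cvg0P.
apply: (@squeeze_cvgr _ _ _ _ (fun=> 0) (fun n => `|u n| * M)).
- near=> n; rewrite normr_ge0/= (le_trans (cauchy_schwarz _ _))//.
  by rewrite ler_wpM2l.
- exact: cvg_cst.
- rewrite -(mul0r M); apply: cvgM; last exact: cvg_cst.
  exact/norm_cvg0P.
Unshelve. all: by end_near. Qed.

(** The functionals [ip (u n)] are pointwise bounded because convergent real sequences are, hence
    uniformly bounded on the unit ball. Evaluating each at the normalized vector [u n] recovers its
    norm. *)
Lemma weakly_cvg_bounded u x :
  weakly_cvg_to ip u x -> exists M : R, forall n, `|u n| <= M.
Proof.
move=> ux.
pose F := range (fun n => ip (u n) : X -> R^o).
have : @uniform_bounded R X R^o F.
  apply: Banach_Steinhauss => [_ [n _ <-]|y].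
    split=> [r|a s t]; last by rewrite ipDr ipZr.
    exists (`|u n| * r) => s sr.
    by rewrite (le_trans (cauchy_schwarz _ _))// ler_wpM2l.
  have /cvg_seq_bounded := cvgP _ (ux y).
  move=> [M [_ /(_ (M + 1))]]; rewrite ltrDl ltr01 => /(_ isT) uM.
  by exists (M + 1) => _ [n _ <-]; exact: uM.
move=> /(_ 1) [M FM]; exists M => n.
have [->|un0] := eqVneq (u n) 0.
  rewrite normr0; apply: le_trans (FM _ _ 0 _); first exact: normr_ge0.
    by exists 0%N.
  by rewrite normr0.
have N0 : `|u n| != 0 by rewrite normr_eq0.
have := FM (ip (u n)) _ (`|u n|^-1 *: u n).
rewrite ipZr ipxx expr2 mulKf// normr_id; apply; first by exists n.
by rewrite normrZ normfV normr_id mulVf.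
Qed.

Lemma affine_nearest_point A x :
  affine_subspace A -> closed A -> exists p, nearest_point A x p.
Proof.
move=> [[a0 Aa0] Aaff] Acl.
pose E := [set `|x - s| ^+ 2 | s in A].
have Einf : has_inf E.
  split; first by exists (`|x - a0| ^+ 2), a0.
  by exists 0 => _ [s _ <-]; rewrite sqr_ge0.
have dle s : A s -> inf E <= `|x - s| ^+ 2.
  by move=> As; apply: ge_inf; [exact: Einf.2|exists s].
have /choice[s sP] (n : nat) :
    exists s, A s /\ `|x - s| ^+ 2 < inf E + n.+1%:R^-1.
  have n0 : 0 < n.+1%:R^-1 :> R by rewrite invr_gt0.
  by have [_ [s As <-] ?] := inf_adherent n0 Einf; exists s.
(* Parallelogram identity: the midpoint of [s n] and [s m] lies in [A], so its squared distance to
   [x] is at least [inf E]. A minimizing sequence is therefore Cauchy, and completeness provides its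
   limit. *)
have sn_le n m : `|s n - s m| ^+ 2 <= 2 * n.+1%:R^-1 + 2 * m.+1%:R^-1.
  have [[An dn] [Am dm]] := (sP n, sP m).
  have /dle := Aaff _ _ (2^-1) An Am.
  have -> : x - (2^-1 *: s n + (1 - 2^-1) *: s m) =
      2^-1 *: ((x - s n) + (x - s m)).
    have -> : 1 - 2^-1 = 2^-1 :> R by field.
    rewrite -scalerDr addrACA -opprD scalerBr; congr (_ - _).
    by rewrite -[x + x]mulr2n -[x *+ 2]scaler_nat scalerA mulVf// scale1r.
  rewrite normrZ exprMn (sqr_normD (x - s n)).
  have -> : s n - s m = (x - s m) - (x - s n).
    by rewrite opprB [RHS]addrC addrA subrK.
  rewrite (sqr_normB (x - s m)) (ipC (x - s m)) normfV normr_nat.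
  have -> : (2^-1 : R) ^+ 2 = 4^-1 by field.
  move: dn dm; move: (n.+1%:R^-1) (m.+1%:R^-1) => en em; lra.
have /cauchy_cvgP/cvg_ex[/= p sp] : cauchy (s @ \oo).
  apply/cauchy_ballP => e e0.
  have e4 : 0 < e ^+ 2 / 4 by rewrite divr_gt0// exprn_gt0.
  have near4 : \forall n \near \oo, n.+1%:R^-1 < e ^+ 2 / 4.
    exact: near_infty_natSinv_lt (PosNum e4).
  near_simpl; near=> n m => /=; rewrite -ball_normE /=.
  rewrite -(@ltr_pXn2r _ 2)// ?nnegrE// ?ltW//.
  have : n.+1%:R^-1 < e ^+ 2 / 4 by near: n.
  have : m.+1%:R^-1 < e ^+ 2 / 4 by near: m.
  by have := sn_le n m; move: (n.+1%:R^-1) (m.+1%:R^-1) => en em; lra.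
have Ap : A p by apply: (closed_cvg A Acl _ p sp); near=> n; have [] := sP n.
exists p; split=> // t At.
rewrite -(@ler_pXn2r _ 2)// ?nnegrE//; apply: le_trans (dle _ At).
have dcvg : `|x - s n| ^+ 2 @[n --> \oo] --> `|x - p| ^+ 2.
  rewrite expr2; apply: cvgM; apply: cvg_norm; apply: cvgB => //;
    exact: cvg_cst.
have ecvg : inf E + n.+1%:R^-1 @[n --> \oo] --> inf E.
  rewrite -[X in _ --> X]addr0; apply: cvgD; first exact: cvg_cst.
  exact: cvg_harmonic.
apply: (ler_cvg_to dcvg ecvg); near=> n; exact/ltW/(sP n).2.
Unshelve. all: by end_near. Qed.

Lemma nearest_point_orthogonal A x p y : affine_subspace A ->
  nearest_point A x p -> A y -> ip (x - p) (y - p) = 0.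
Proof.
move=> [_ Aaff] [Ap pmin] Ay.
have [/eqP|yp] := eqVneq (y - p) 0; first by move=> /eqP ->; rewrite linear0r.
have b0 : 0 < `|y - p| ^+ 2 by rewrite exprn_gt0// normr_gt0.
set a := ip _ _; set b := _ ^+ 2 in b0.
(* The weight [a / b] minimizes the squared distance from [x] along the line through [p] and [y]. It
   lowers the value at [p] by [a ^+ 2 / b], which minimality of [p] forces to be 0. *)
have := pmin _ (Aaff _ _ (a / b) Ay Ap).
have -> : x - (a / b *: y + (1 - a / b) *: p) = (x - p) - a / b *: (y - p).
  rewrite scalerBl scale1r scalerBr !opprD !opprK -!addrA; congr (_ + _).
  by rewrite addrCA.
rewrite -(@ler_pXn2r _ 2)// ?nnegrE// (sqr_normB (x - p)) ipZr -/a
  normrZ exprMn -/b.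
rewrite real_normK ?num_real//.
have -> : (a / b) ^+ 2 * b = a ^+ 2 / b by field; rewrite gt_eqF.
have -> : 2 * (a / b * a) = 2 * (a ^+ 2 / b) by field; rewrite gt_eqF.
have : 0 <= a ^+ 2 / b by rewrite divr_ge0 ?sqr_ge0// ltW.
move=> h0 h1; have /eqP : a ^+ 2 / b = 0 by lra.
by rewrite mulf_eq0 invr_eq0 (gt_eqF b0) orbF sqrf_eq0 => /eqP.
Qed.

(** Existence of a nearest point rules out the default value of [xget]. *)
Lemma projector_mem A x : affine_subspace A -> closed A -> A (projector A x).
Proof.
move=> Aaff Acl; have [p pP] := affine_nearest_point x Aaff Acl.
by have [] := xgetI 0 pP.
Qed.

(** With [p] nearest to [x] in [A], orthogonality makes [ip (u n) (x - p)] constantly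
    [ip p (x - p)]. Its limit is also [ip x (x - p)], so [x - p] has norm 0. *)
Lemma affine_weakly_closed A u x : affine_subspace A -> closed A ->
  (forall n, A (u n)) -> weakly_cvg_to ip u x -> A x.
Proof.
move=> Aaff Acl Au ux.
have [p px] := affine_nearest_point x Aaff Acl.
suff -> : x = p by case: px.
apply/eqP; rewrite -subr_eq0 -normr_eq0 -sqrf_eq0 -ipxx ipBl subr_eq0.
apply/eqP/(cvg_unique _ (ux (x - p))) => //=.
under eq_cvg => n.
  have -> : ip (u n) (x - p) = ip p (x - p); last over.
  apply/eqP; rewrite -subr_eq0 -ipBl ipC.
  by rewrite (nearest_point_orthogonal Aaff px).
exact: cvg_cst.
Qed.

Lemma weakly_cvg_sub0 u v x : weakly_cvg_to ip u x ->
  u n - v n @[n --> \oo] --> (0 : X) -> weakly_cvg_to ip v x.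
Proof.
move=> ux uv0 y; rewrite -(subr0 (ip x y)).
under eq_cvg => n do rewrite -(subKr (u n) (v n)) ipBl.
by apply: cvgB => //; exact: (@ip_cvg0l _ (fun=> y) `|y|).
Qed.

Lemma weakly_cvgB u v x y : weakly_cvg_to ip u x -> weakly_cvg_to ip v y ->
  weakly_cvg_to ip (fun n => u n - v n) (x - y).
Proof.
move=> ux vy w; rewrite ipBl.
under eq_cvg do rewrite ipBl.
exact: cvgB.
Qed.

(** Since [x - y] is the sum of the two arguments of [ip], expanding its squared norm leaves twice
    this inner product as the slack in firm nonexpansiveness. *)
Lemma firmly_nonexpansive_monotone (F : X -> X) x y : firmly_nonexpansive F ->
  0 <= ip (F x - F y) ((x - F x) - (y - F y)).
Proof.
move=> /(_ x y).
have -> : x - y = (F x - F y) + ((x - F x) - (y - F y)).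
  by rewrite addrACA -opprD !subrKC.
by rewrite (sqr_normD (F x - F y)); lra.
Qed.

(* The projections of u n and v n differ from the weak limits x and y by
   mutually orthogonal vectors; this is what makes the product of two merely
   weakly convergent sequences converge to ip x y. *)
Lemma ip_cvg_affine A B u v x y :
  affine_subspace A -> closed A -> affine_subspace B -> closed B ->
  (forall a a' b b', A a -> A a' -> B b -> B b' -> ip (a - a') (b - b') = 0) ->
  u n - projector A (u n) @[n --> \oo] --> (0 : X) ->
  v n - projector B (v n) @[n --> \oo] --> (0 : X) ->
  weakly_cvg_to ip u x -> weakly_cvg_to ip v y ->
  [/\ A x, B y & ip (u n) (v n) @[n --> \oo] --> ip x y].
Proof.
move=> Aaff Acl Baff Bcl AB uA vB ux vy.
pose p n := projector A (u n); pose q n := projector B (v n).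
have px : weakly_cvg_to ip p x := weakly_cvg_sub0 ux uA.
have qy : weakly_cvg_to ip q y := weakly_cvg_sub0 vy vB.
have Ap n : A (p n) by exact: projector_mem.
have Bq n : B (q n) by exact: projector_mem.
have Ax := affine_weakly_closed Aaff Acl Ap px.
have By := affine_weakly_closed Baff Bcl Bq qy.
split=> //.
have [M pM] := weakly_cvg_bounded px.
have [N vN] := weakly_cvg_bounded vy.
(* The first two terms pair a norm-null sequence with a bounded one. The bracket equals
   [ip (p n) (q n)], because [p n - x] and [q n - y] are orthogonal, and it involves only pairings
   with fixed vectors. *)
have -> : (fun n => ip (u n) (v n)) =
    (fun n => ip (u n - p n) (v n) + ip (v n - q n) (p n)
              + (ip (p n) y + ip (q n) x - ip x y)).
  apply/funext => n; have := AB _ _ _ _ (Ap n) Ax (Bq n) By.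
  rewrite !ipBr !ipBl (ipC (v n)) (ipC (q n) x) (ipC (q n) (p n)) /=; lra.
rewrite [X in _ --> X](_ : _ = 0 + 0 + (ip x y + ip y x - ip x y)); last first.
  by rewrite (ipC y x); ring.
apply: cvgD; first by apply: cvgD; exact: ip_cvg0l.
exact: (cvgB (cvgD (px y) (qy x)) (cvg_cst _)).
Qed.

End InnerProduct.

Theorem corollary2p4 (R : realType) (X : completeNormedModType R)
    (ip : {dot X for idfun}) (ip_norm : induces_norm ip)
    (F : X -> X) (F_firm : firmly_nonexpansive F)
    (z_ : nat -> X) (z x : X) (C D : set X)
    (z_weak : weakly_cvg_to ip z_ z)
    (Fz_weak : weakly_cvg_to ip (fun n => F (z_ n)) x)
    (C_affine : affine_subspace C) (C_closed : closed C)
    (D_affine : affine_subspace D) (D_closed : closed D)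
    (DC : set_sub D D = orthogonal_complement ip (set_sub C C))
    (FzC : F (z_ n) - projector C (F (z_ n)) @[n --> \oo] --> (0 : X))
    (FzD : (z_ n - F (z_ n)) - projector D (z_ n - F (z_ n)) @[n --> \oo]
             --> (0 : X)) :
  [/\ C x, translate x D z & x = F z].
Proof.
have CD a a' b b' : C a -> C a' -> D b -> D b' -> ip (a - a') (b - b') = 0.
  move=> Ca Ca' Db Db'; rewrite ipC.
  have : set_sub D D (b - b') by exists b => //; exists b'.
  by rewrite DC; apply; exists a => //; exists a'.
have gz := weakly_cvgB z_weak Fz_weak.
have [Cx Dzx fg] := ip_cvg_affine ip_norm C_affine C_closed D_affine D_closed
  CD FzC FzD Fz_weak gz.
split=> //; first by exists (z - x) => //; rewrite subrKC.
(* Monotonicity at [z_ n] and [z], expanded so that each term has a known limit: the product by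
   [fg], the others by weak convergence. *)
have mono n : 0 <= ip (F (z_ n)) (z_ n - F (z_ n)) - ip (F (z_ n)) (z - F z)
    - ip (z_ n - F (z_ n)) (F z) + ip (F z) (z - F z).
  have := firmly_nonexpansive_monotone ip_norm (z_ n) z F_firm.
  rewrite !ipBr !ipBl (ipC ip (F z) (F (z_ n))) (ipC ip (F z) (z_ n)); lra.
have : 0 <= ip x (z - x) - ip x (z - F z) - ip (z - x) (F z)
    + ip (F z) (z - F z).
  have lim := cvgD (cvgB (cvgB fg (Fz_weak (z - F z))) (gz (F z)))
    (cvg_cst (ip (F z) (z - F z))).
  by apply: (ler_cvg_to (cvg_cst 0) (lim _ _ _ _)); near=> n; exact: mono.
have -> : ip x (z - x) - ip x (z - F z) - ip (z - x) (F z) + ip (F z) (z - F z)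
    = - `|x - F z| ^+ 2.
  rewrite -(ipxx ip_norm) !ipBr !ipBl /= (ipC ip (F z) z).
  rewrite (ipC ip (F z) x); ring.
rewrite oppr_ge0 => h; apply/eqP; rewrite -subr_eq0 -normr_eq0 -sqrf_eq0.
by rewrite eq_le h sqr_ge0.
Unshelve. all: by end_near. Qed.
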